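(* Let $\alpha:I\to\mathbb{R}^3$ be a unit speed space curve on an open interval $I$, with curvature $\kappa=\kappa(s)\neq 0$ for all $s\in I$ and torsion $\tau=\tau(s)$. Then the following statements are equivalent: (1) $\alpha$ is a general helix. (2) There is a constant $m\in\mathbb{R}$ such that $\dfrac{\tau}{\kappa}(s)=m$ for all $s\in I$. (3) There is a constant $m\in\mathbb{R}$ such that, up to a rigid motion of $\mathbb{R}^3$, $\alpha(s)=(x(s),y(s),z(s))$, where $$x(s)=\frac{1}{\sqrt{1+m^2}}\int\cos\left(\sqrt{1+m^2}\int\kappa\,ds\right)ds,$$ $$y(s)=\frac{1}{\sqrt{1+m^2}}\int\sin\left(\sqrt{1+m^2}\int\kappa\,ds\right)ds,$$ $$z(s)=\frac{m s}{\sqrt{1+m^2}}.$$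
   Context: Curves are assumed sufficiently differentiable for the following to make sense. For a unit speed curve, $\mathbf{t}=\alpha'$, the curvature is $\kappa=\|\alpha''\|$, and when $\kappa\neq 0$ one sets $\mathbf{n}=\alpha''/\kappa$, $\mathbf{b}=\mathbf{t}\wedge\mathbf{n}$; the torsion $\tau$ is defined by the Frenet equations $\frac{d\mathbf{t}}{ds}=\kappa\mathbf{n}$, $\frac{d\mathbf{n}}{ds}=-\kappa\mathbf{t}+\tau\mathbf{b}$, $\frac{d\mathbf{b}}{ds}=-\tau\mathbf{n}$. A curve $\alpha$ with $\kappa(s)\neq 0$ is called a general helix if its tangent lines make a constant angle with a fixed direction, i.e. there is a fixed unit vector $U$ such that $\langle\mathbf{t}(s),U\rangle$ is constant. A rigid motion is a map $p\mapsto\rho(p)+c$ with $\rho$ an orthogonal linear map of $\mathbb{R}^3$ of positive determinant and $c\in\mathbb{R}^3$. Indefinite integrals denote antiderivatives on $I$, the same antiderivative of $\kappa$ being used in $x$ and $y$. *)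

(* Defs.v *)
From HB Require Import structures.
From mathcomp Require Import all_boot all_order all_algebra.
From mathcomp Require Import all_classical all_reals all_analysis.

Set Implicit Arguments.
Unset Strict Implicit.
Unset Printing Implicit Defensive.

Import Order.TTheory GRing.Theory Num.Theory.
Import numFieldNormedType.Exports.

Local Open Scope ring_scope.
Local Open Scope classical_set_scope.

(* Vectors of R^3 are row vectors.  The norm `|u| that the library puts on
   'rV[R]_3 is the sup norm (it induces the usual topology, hence the usual
   derivatives), so the Euclidean structure is introduced separately. *)
Definition vec3 (R : realType) (x y z : R) : 'rV[R]_3 :=
  \row_(i < 3) [:: x; y; z]`_i.

Definition dot (R : realType) (u v : 'rV[R]_3) : R :=
  \sum_(i < 3) u 0 i * v 0 i.

Definition enorm (R : realType) (u : 'rV[R]_3) : R := Num.sqrt (dot u u).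

Definition cross (R : realType) (u v : 'rV[R]_3) : 'rV[R]_3 :=
  vec3 (u 0 1 * v 0 2 - u 0 2 * v 0 1)
       (u 0 2 * v 0 0 - u 0 0 * v 0 2)
       (u 0 0 * v 0 1 - u 0 1 * v 0 0).

(* Possibly unbounded. *)
Definition open_interval (R : realType) (I : set R) : Prop :=
  open I /\ is_interval I.

(* A curve I -> R^3 is a total function R -> 'rV[R]_3 of which only the
   values on the open interval I matter.  Three derivatives are what the
   differentiability of the Frenet frame requires. *)
Definition thrice_differentiable (R : realType) (I : set R)
    (alpha : R -> 'rV[R]_3) : Prop :=
  forall k : nat, (k < 3)%N -> forall s, I s -> derivable (alpha^`(k)) s 1.

Definition tangent (R : realType) (alpha : R -> 'rV[R]_3) : R -> 'rV[R]_3 :=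
  alpha^`().

Definition unit_speed (R : realType) (I : set R) (alpha : R -> 'rV[R]_3) :
    Prop :=
  forall s, I s -> enorm (tangent alpha s) = 1.

Definition curvature (R : realType) (alpha : R -> 'rV[R]_3) (s : R) : R :=
  enorm (alpha^`(2) s)%classic.

Definition normal (R : realType) (alpha : R -> 'rV[R]_3) (s : R) : 'rV[R]_3 :=
  (curvature alpha s)^-1 *: (alpha^`(2) s)%classic.

Definition binormal (R : realType) (alpha : R -> 'rV[R]_3) (s : R) :
    'rV[R]_3 :=
  cross (tangent alpha s) (normal alpha s).

(* When alpha has unit speed, nonvanishing curvature and three derivatives,
   exactly one function on I satisfies the Frenet equations, namely
   s |-> dot (n'(s)) (b(s)). *)
Definition is_torsion (R : realType) (I : set R) (alpha : R -> 'rV[R]_3)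
    (tau : R -> R) : Prop :=
  forall s, I s ->
    [/\ is_derive s 1 (tangent alpha) (curvature alpha s *: normal alpha s),
        is_derive s 1 (normal alpha)
          (- curvature alpha s *: tangent alpha s + tau s *: binormal alpha s)
      & is_derive s 1 (binormal alpha) (- tau s *: normal alpha s)].

Definition general_helix (R : realType) (I : set R) (alpha : R -> 'rV[R]_3) :
    Prop :=
  (forall s, I s -> curvature alpha s != 0) /\
  exists U : 'rV[R]_3, enorm U = 1 /\
    exists c : R, forall s, I s -> dot (tangent alpha s) U = c.

Definition antiderivative (R : realType) (I : set R) (f F : R -> R) : Prop :=
  forall s, I s -> is_derive s 1 F (f s).

(* Linear maps act on row vectors by right multiplication. *)
Definition rigid_motion (R : realType) (M : 'rV[R]_3 -> 'rV[R]_3) : Prop :=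
  exists (rho : 'M[R]_3) (c : 'rV[R]_3),
    [/\ rho *m rho^T = 1%:M, 0 < \det rho & forall p, M p = p *m rho + c].

(* Main.v *)
Require Import Defs.
From HB Require Import structures.
From mathcomp Require Import all_boot all_order all_algebra.
From mathcomp Require Import all_classical all_reals all_analysis.
From mathcomp Require Import ring lra.

(** Write t, n, b for the Frenet frame, k for the curvature, F for the matrix
    with rows t, n, b, and A for the skew matrix with F' = A F.

    A helix has constant torsion ratio: if <t, U> = c is constant, then
    differentiating gives <n, U> = 0, and differentiating that gives
    k c = tau <b, U>.  By the third Frenet equation <b, U> is a constant d,
    which is nonzero, since otherwise c = 0 too and U would vanish.  So
    tau / k = c / d ([helix_torsion_ratio]).

    Constant torsion ratio gives the parametrization: when tau = m k, put
    w = sqrt (1 + m^2).  The axis (m t + b) / w does not move, and in the plane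
    orthogonal to it the orthonormal pair (t - m b) / w, n turns at angular
    speed w k.  Turning it back by the angle w K, where K' = k, therefore yields
    a fixed frame.  In matrix form, with the explicit rotation
    S = [slant m (w K)], one has S' = - S A ([is_derive_slant]), so that
    rho = S F is a constant rotation.  In the coordinates given by rho the
    velocity is t rho^T = t F^T S^T, the first column of S, that is
    (cos (w K) / w, sin (w K) / w, m / w).  Hence the coordinates of alpha
    themselves serve as the antiderivatives X and Y, and only K has to be
    produced by integration ([torsion_ratio_param]).

    Conversely the parametrized curve has velocity of constant height m / w, so
    it makes a constant angle with the image of the third axis
    ([param_helix]). *)

Set Implicit Arguments.
Unset Strict Implicit.
Unset Printing Implicit Defensive.

Import Order.TTheory GRing.Theory Num.Theory.
Import numFieldNormedType.Exports.

Local Open Scope ring_scope.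
Local Open Scope classical_set_scope.

(** * Calculus on an interval, entry by entry for matrices *)

Section calculus.
Variable R : realType.
Implicit Types (I : set R) (f g F : R -> R) (s : R).

Lemma is_derive_mxP (m n : nat) (M : R -> 'M[R]_(m, n)) s dM :
  is_derive s 1 M dM <->
  forall i j, is_derive s 1 (fun x => M x i j) (dM i j).
Proof.
split=> [[dMs <-] i j|dMs].
  rewrite (derive_mx dMs) mxE; apply: DeriveDef => //.
  exact: ((derivable_mxP M s 1).1 dMs).
have Ms : derivable M s 1 by apply/derivable_mxP => i j; case: (dMs i j).
apply: DeriveDef => //; rewrite (derive_mx Ms); apply/matrixP => i j.
by rewrite mxE; case: (dMs i j).
Qed.

Lemma is_derive_mulmx (m n p : nat) (A : R -> 'M[R]_(m, n))
    (B : R -> 'M[R]_(n, p)) s dA dB :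
  is_derive s 1 A dA -> is_derive s 1 B dB ->
  is_derive s 1 (fun x => A x *m B x) (dA *m B s + A s *m dB).
Proof.
move=> /is_derive_mxP As /is_derive_mxP Bs; apply/is_derive_mxP => i j.
have -> : (fun x => (A x *m B x) i j) =
    \sum_(k < n) ((fun x => A x i k) * (fun x => B x k j)).
  by apply/funext => x; rewrite mxE fct_sumE.
pose AB k := (fun x => A x i k) * (fun x => B x k j).
have /(@is_derive_sum _ _ _ n AB) : forall k,
    is_derive s 1 (AB k) (A s i k *: dB k j + B s k j *: dA i k).
  by move=> k; apply: is_deriveM.
move=> dAB; apply: (is_derive_eq dAB).
rewrite !mxE -big_split/=; apply: eq_bigr => k _.
by rewrite addrC; congr (_ + _); exact: mulrC.
Qed.

Lemma is_derive_continuous f s df : is_derive s 1 f df -> {for s, continuous f}.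
Proof. by move=> [fs _]; exact/differentiable_continuous/derivable1_diffP. Qed.

Lemma interval_sub I a b : is_interval I -> I a -> I b -> `[a, b] `<=` I.
Proof. by move=> Iitv Ia Ib x /=; rewrite in_itv/=; exact: Iitv. Qed.

Lemma is_derive0_cst_itv I f : is_interval I ->
  (forall s, I s -> is_derive s 1 f 0) ->
  forall x y, I x -> I y -> f x = f y.
Proof.
move=> Iitv f0 x y.
wlog xy : x y / x <= y.
  by move=> H; case: (leP x y) => [/H //|/ltW /H h Ix Iy]; rewrite h.
move=> Ix Iy; have sub := interval_sub Iitv Ix Iy.
have [| |c _] := @MVT_segment _ f (cst 0) x y xy.
- by move=> z /subset_itv_oo_cc /sub /f0.
- apply: continuous_in_subspaceT => z; rewrite inE => /sub /f0.
  exact: is_derive_continuous.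
by rewrite /= mul0r => /eqP; rewrite subr_eq0 => /eqP.
Qed.

Lemma is_derive0_cst_itv_mx (m n : nat) I (M : R -> 'M[R]_(m, n)) :
  is_interval I -> (forall s, I s -> is_derive s 1 M 0) ->
  forall x y, I x -> I y -> M x = M y.
Proof.
move=> Iitv M0 x y Ix Iy; apply/matrixP => i j.
apply: (is_derive0_cst_itv (f := fun x => M x i j) Iitv) => // s /M0.
by move=> /is_derive_mxP /(_ i j); rewrite mxE.
Qed.

Lemma open_interval_around I s : open I -> I s ->
  exists a b, [/\ a < s, s < b, I a & I b].
Proof.
move=> oI Is; have /nbhs_ballP[e /= e0 be] : nbhs s I by exact: open_nbhs_nbhs.
exists (s - e / 2), (s + e / 2).
have e2 : `|e / 2| < e by rewrite gtr0_norm ?divr_gt0//; lra.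
split; rewrite ?ltrDl ?gtrBl ?divr_gt0//; apply: be; rewrite /ball/=.
- by rewrite opprB addrC subrK.
- by rewrite opprD addrA subrr sub0r normrN.
Qed.

(** The antiderivative based at a point [a] of [I] is a signed integral, and
    the fundamental theorem only covers integrals from a fixed left endpoint.
    Near [s] one therefore rewrites it, up to a constant, as the integral from
    some [l'] in [I] to the left of both [a] and [s]. *)
Lemma antiderivative_exists I f : open_interval I ->
  (forall s, I s -> {for s, continuous f}) -> exists F, antiderivative I f F.
Proof.
move=> [oI Iitv] fc.
have [->|/set0P[a Ia]] := eqVneq I set0; first by exists (cst 0).
pose mu := @lebesgue_measure R.
pose Int x y : R := (\int[mu]_(t in `[x, y]) f t)%R.
have intf x y : I x -> I y -> mu.-integrable `[x, y] (EFin \o f).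
  move=> Ix Iy; apply: continuous_compact_integrable.
    exact: segment_compact.
  apply: continuous_in_subspaceT => z; rewrite inE.
  by move=> /(interval_sub Iitv Ix Iy) /fc.
have chasles x y z : I x -> I z -> x <= y -> y <= z ->
    Int x z = Int x y + Int y z.
  move=> Ix Iz xy yz; apply/eqP; rewrite addrC -subr_eq.
  rewrite Rintegral_itvB ?bnd_simp//; last exact: intf.
  rewrite Rintegral_itv_obnd_cbnd//.
  apply: integrableS (intf _ _ Ix Iz) => //.
  by apply: subset_itv; rewrite bnd_simp.
(* Int x y = 0 when y <= x, so at most one of the two terms is nonzero *)
pose F y := Int a y - Int y a.
have Int1 x : Int x x = 0 by rewrite /Int set_itv1 Rintegral_set1.
have Int0 x y : y <= x -> Int x y = 0.
  rewrite le_eqVlt => /predU1P[->//|yx].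
  by rewrite /Int set_itv_ge ?Rintegral_set0// bnd_simp -ltNge.
have FE l y : I l -> I y -> l <= a -> l <= y -> F y = Int l y - Int l a.
  move=> Il Iy la ly; rewrite /F; have [ay|/ltW ya] := leP a y.
    by rewrite (Int0 _ _ ay) (chasles l a y)// subr0; ring.
  by rewrite (Int0 _ _ ya) (chasles l y a)//; ring.
exists F => s Is.
have [l [u [ls su Il Iu]]] := open_interval_around oI Is.
have [l' [Il' l's l'a]] : exists l', [/\ I l', l' < s & l' <= a].
  have [la|/ltW al] := leP l a; first by exists l.
  by exists a; split => //; exact: le_lt_trans al ls.
have [dI Is'] :=
  @continuous_FTC1_closed R f l' s u su (intf _ _ Il' Iu) l's (fc _ Is).
apply: (@near_eq_is_derive _ _ _ (fun y => Int l' y - Int l' a)).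
  near=> y; rewrite (FE l')//.
    by near: y; exact: open_nbhs_nbhs.
  by apply: ltW; near: y; exact: lt_nbhsr.
have dInt : is_derive s 1 (Int l') (f s).
  by apply: DeriveDef; [exact: dI|rewrite -derive1E].
apply: is_derive_eq (subr0 _).
Unshelve. all: by end_near. Qed.
End calculus.

(** * Vectors and orthogonal matrices in dimension three *)

Section space.
Variable R : realType.
Implicit Types (u v w : 'rV[R]_3) (A : 'M[R]_3).

Definition rows3 u v w : 'M[R]_3 := \matrix_(i < 3) [:: u; v; w]`_i.

Lemma ord3P (P : 'I_3 -> Prop) : P 0 -> P 1 -> P 2%:R -> forall i, P i.
Proof.
move=> P0 P1 P2 [[|[|[|//]]] i3].
- by rewrite (_ : Ordinal i3 = 0)//; exact/val_inj.
- by rewrite (_ : Ordinal i3 = 1)//; exact/val_inj.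
- by rewrite (_ : Ordinal i3 = 2%:R)//; exact/val_inj.
Qed.

Lemma row3P u v :
  u 0 0 = v 0 0 -> u 0 1 = v 0 1 -> u 0 2%:R = v 0 2%:R -> u = v.
Proof. by move=> e0 e1 e2; apply/rowP; exact: ord3P. Qed.

Lemma sum3 (f : 'I_3 -> R) : \sum_i f i = f 0 + f 1 + f 2%:R.
Proof.
rewrite !big_ord_recl big_ord0 addr0 addrA.
by congr (f _ + f _ + f _); exact/val_inj.
Qed.

Lemma dotE u v : dot u v = u 0 0 * v 0 0 + u 0 1 * v 0 1 + u 0 2%:R * v 0 2%:R.
Proof. exact: sum3. Qed.

Lemma dot_mulmx u v : dot u v = (u *m v^T) 0 0.
Proof. by rewrite mxE; apply: eq_bigr => i _; rewrite mxE. Qed.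

Lemma vec3E0 (x y z : R) : vec3 x y z 0 0 = x. Proof. by rewrite mxE. Qed.
Lemma vec3E1 (x y z : R) : vec3 x y z 0 1 = y. Proof. by rewrite mxE. Qed.
Lemma vec3E2 (x y z : R) : vec3 x y z 0 2%:R = z. Proof. by rewrite mxE. Qed.
Definition vec3E := (vec3E0, vec3E1, vec3E2).

Lemma rows3E0 u v w j : rows3 u v w 0 j = u 0 j. Proof. by rewrite mxE. Qed.
Lemma rows3E1 u v w j : rows3 u v w 1 j = v 0 j. Proof. by rewrite mxE. Qed.
Lemma rows3E2 u v w j : rows3 u v w 2%:R j = w 0 j. Proof. by rewrite mxE. Qed.
Definition rows3E := (rows3E0, rows3E1, rows3E2).

Lemma det_rows3 u v w : \det (rows3 u v w) = dot (cross u v) w.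
Proof.
rewrite (expand_det_row _ (2%:R : 'I_3)) sum3 dotE !rows3E /cofactor.
rewrite !(expand_det_row _ (0 : 'I_2)) !big_ord_recl !big_ord0.
rewrite /cofactor !det_mx11 !mxE.
(* naming the coordinates by naturals lets the nested lifts compute away *)
have coord (x : 'rV[R]_3) : exists X : nat -> R, forall i, x 0 i = X i.
  by exists (fun k => x 0 (inord k)) => i; rewrite inord_val.
have [[U uE] [V vE] [W wE]] := And3 (coord u) (coord v) (coord w).
by rewrite !(uE, vE, wE) /bump /=; ring.
Qed.

Lemma trmx_rows3 u v w (x : 'rV[R]_3) :
  x *m (rows3 u v w)^T = vec3 (dot x u) (dot x v) (dot x w).
Proof.
by apply: row3P; rewrite vec3E dot_mulmx !mxE; apply: eq_bigr => k _;
  rewrite !mxE.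
Qed.

Lemma mul_rows3 u v w (x : 'rV[R]_3) :
  x *m rows3 u v w = x 0 0 *: u + x 0 1 *: v + x 0 2 *: w.
Proof. by apply/rowP => j; rewrite mxE sum3 !rows3E !mxE. Qed.

Lemma rows3_mul u v w A : rows3 u v w *m A = rows3 (u *m A) (v *m A) (w *m A).
Proof.
apply/matrixP => i j; elim/ord3P: i; rewrite rows3E !mxE;
  by apply: eq_bigr => k _; rewrite rows3E.
Qed.

(** Lagrange's identity makes the cross product a unit vector, and the
    determinant is then its squared norm. *)
Lemma right_handed_orthogonal u v (F := rows3 u v (cross u v)) :
  dot u u = 1 -> dot v v = 1 -> dot u v = 0 ->
  F *m F^T = 1%:M /\ \det F = 1.
Proof.
move=> uu vv uv.
have ucr : dot u (cross u v) = 0 by rewrite dotE /cross !vec3E; ring.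
have vcr : dot v (cross u v) = 0 by rewrite dotE /cross !vec3E; ring.
have crcr : dot (cross u v) (cross u v) = 1.
  have -> : dot (cross u v) (cross u v) = dot u u * dot v v - dot u v ^+ 2.
    by rewrite !dotE /cross !vec3E; ring.
  by rewrite uu vv uv expr0n mulr1 subr0.
have dotC (x y : 'rV[R]_3) : dot x y = dot y x by rewrite !dotE; ring.
split; last by rewrite det_rows3.
rewrite rows3_mul !trmx_rows3 uu vv uv ucr vcr crcr.
rewrite (dotC v u) (dotC (cross u v) u) (dotC (cross u v) v) uv ucr vcr.
by apply/matrixP => i j; elim/ord3P: i; elim/ord3P: j; rewrite !mxE.
Qed.
End space.

(** * The Frenet frame and the rotation that freezes it *)

Section moving_frame.
Variable R : realType.
Implicit Types (u v w : 'rV[R]_3) (A : 'M[R]_3) (I : set R) (s : R).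

Lemma is_derive_trmx (m n : nat) (M : R -> 'M[R]_(m, n)) s dM :
  is_derive s 1 M dM -> is_derive s 1 (fun x => (M x)^T) dM^T.
Proof.
move=> /is_derive_mxP Ms; apply/is_derive_mxP => i j; rewrite mxE.
by under eq_fun do rewrite mxE.
Qed.

Lemma is_derive_dot (f g : R -> 'rV[R]_3) s df dg :
  is_derive s 1 f df -> is_derive s 1 g dg ->
  is_derive s 1 (fun x => dot (f x) (g x)) (dot df (g s) + dot (f s) dg).
Proof.
move=> fs /is_derive_trmx gs.
under eq_fun do rewrite dot_mulmx.
rewrite !dot_mulmx; have /is_derive_mxP/(_ 0 0) := is_derive_mulmx fs gs.
by rewrite mxE.
Qed.

Lemma is_derive_vec3 (f g h : R -> R) s df dg dh :
  is_derive s 1 f df -> is_derive s 1 g dg -> is_derive s 1 h dh ->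
  is_derive s 1 (fun x => vec3 (f x) (g x) (h x)) (vec3 df dg dh).
Proof.
move=> fs gs hs; apply/is_derive_mxP => i; rewrite [i]ord1; elim/ord3P;
  by under eq_fun do rewrite vec3E; rewrite vec3E.
Qed.

Lemma is_derive_rows3 (f g h : R -> 'rV[R]_3) s df dg dh :
  is_derive s 1 f df -> is_derive s 1 g dg -> is_derive s 1 h dh ->
  is_derive s 1 (fun x => rows3 (f x) (g x) (h x)) (rows3 df dg dh).
Proof.
move=> /is_derive_mxP fs /is_derive_mxP gs /is_derive_mxP hs.
apply/is_derive_mxP; elim/ord3P => j;
  by under eq_fun do rewrite rows3E; rewrite rows3E.
Qed.

Lemma sqr_enorm u : enorm u ^+ 2 = dot u u.
Proof.
by rewrite sqr_sqrtr//; apply: sumr_ge0 => i _; rewrite -expr2 sqr_ge0.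
Qed.

Lemma enorm_eq1 u : enorm u = 1 -> dot u u = 1.
Proof. by move=> u1; rewrite -sqr_enorm u1 expr1n. Qed.

Definition frame (alpha : R -> 'rV[R]_3) (s : R) : 'M[R]_3 :=
  rows3 (tangent alpha s) (normal alpha s) (binormal alpha s).

Definition frenet_mx (k t : R) : 'M[R]_3 :=
  rows3 (vec3 0 k 0) (vec3 (- k) 0 t) (vec3 0 (- t) 0).

Lemma is_derive_frame I alpha tau s : is_torsion I alpha tau -> I s ->
  is_derive s 1 (frame alpha)
    (frenet_mx (curvature alpha s) (tau s) *m frame alpha s).
Proof.
move=> tors /tors[dt dn db]; apply: (is_derive_eq (is_derive_rows3 dt dn db)).
rewrite rows3_mul !mul_rows3 !vec3E.
by rewrite !scale0r !add0r !addr0.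
Qed.

(** Orthogonality of the tangent and the normal comes from differentiating
    [dot t t = 1]; openness of [I] makes that equation hold near [s]. *)
Lemma frame_orthogonal I alpha tau s : open I -> unit_speed I alpha ->
    (forall x, I x -> curvature alpha x != 0) -> is_torsion I alpha tau ->
    I s ->
  frame alpha s *m (frame alpha s)^T = 1%:M /\ \det (frame alpha s) = 1.
Proof.
move=> oI speed k0 tors Is; apply: right_handed_orthogonal.
- exact/enorm_eq1/speed.
- have -> : dot (normal alpha s) (normal alpha s) =
      (curvature alpha s)^-1 ^+ 2 * curvature alpha s ^+ 2.
    by rewrite sqr_enorm !dotE !mxE; ring.
  by rewrite -exprMn mulVf ?expr1n ?k0.
- have [dt _ _] := tors s Is.
  have dtt := is_derive_dot dt dt.
  have : is_derive s 1 (cst (1 : R))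
      (dot (curvature alpha s *: normal alpha s) (tangent alpha s) +
       dot (tangent alpha s) (curvature alpha s *: normal alpha s)).
    apply: near_eq_is_derive dtt; near=> x; apply/enorm_eq1/speed.
    by near: x; exact: open_nbhs_nbhs.
  move=> /@derive_val; rewrite derive_val => /esym d0.
  apply: (mulfI (k0 s Is)); rewrite mulr0.
  move: d0; rewrite !dotE !mxE; lra.
Unshelve. all: by end_near. Qed.

(** Coordinates, relative to a Frenet frame with torsion ratio [m], of three
    vectors that stay fixed when [th] is the total turning angle: the pair
    (t - m b) / w, n rotated by [- th], and the axis (m t + b) / w. *)
Definition slant (m th : R) : 'M[R]_3 :=
  let w := Num.sqrt (1 + m ^+ 2) in
  rows3 (vec3 (w^-1 * cos th) (- sin th) (- (m / w) * cos th))
        (vec3 (w^-1 * sin th) (cos th) (- (m / w) * sin th))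
        (vec3 (m / w) 0 w^-1).

Lemma slant_norm_gt0 (m : R) : 0 < Num.sqrt (1 + m ^+ 2).
Proof. by rewrite sqrtr_gt0 ltr_wpDr ?sqr_ge0. Qed.

Lemma sqr_slant_norm (m : R) : Num.sqrt (1 + m ^+ 2) ^+ 2 = 1 + m ^+ 2.
Proof. by rewrite sqr_sqrtr// addr_ge0 ?sqr_ge0. Qed.

Lemma slant_orthogonal m th :
  slant m th *m (slant m th)^T = 1%:M /\ \det (slant m th) = 1.
Proof.
rewrite /slant; have := lt0r_neq0 (slant_norm_gt0 m); have := sqr_slant_norm m.
set w := Num.sqrt _ => w2 w0.
have cs := cos2Dsin2 th.
set u := vec3 (_ * cos _) _ _; set v := vec3 (_ * sin _) _ _.
have -> : vec3 (m / w) 0 w^-1 = cross u v.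
  apply: row3P; rewrite !vec3E/=.
  - transitivity (m / w * (cos th ^+ 2 + sin th ^+ 2)); last by field.
    by rewrite cs mulr1.
  - by field.
  - transitivity (w^-1 * (cos th ^+ 2 + sin th ^+ 2)); last by field.
    by rewrite cs mulr1.
apply: right_handed_orthogonal; rewrite dotE !vec3E.
- transitivity (cos th ^+ 2 * (1 + m ^+ 2) / w ^+ 2 + sin th ^+ 2).
    by field.
  by rewrite -w2 mulfK ?expf_neq0.
- transitivity (sin th ^+ 2 * (1 + m ^+ 2) / w ^+ 2 + cos th ^+ 2).
    by field.
  by rewrite -w2 mulfK ?expf_neq0// addrC.
- transitivity
    (cos th * sin th * (1 + m ^+ 2) / w ^+ 2 - cos th * sin th).
    by field.
  by rewrite -w2 mulfK ?expf_neq0// subrr.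
Qed.

(** The Frenet matrix being skew, this says that the transpose of [slant] solves
    the Frenet system; it is chosen so that the product of [slant] and the
    Frenet frame has derivative zero. *)
Lemma is_derive_slant m (K : R -> R) s k (w := Num.sqrt (1 + m ^+ 2)) :
  is_derive s 1 K k ->
  is_derive s 1 (fun x => slant m (w * K x))
    (- (slant m (w * K s) *m frenet_mx k (m * k))).
Proof.
move=> dK; have := lt0r_neq0 (slant_norm_gt0 m); have := sqr_slant_norm m.
rewrite /slant -/w => w2 w0.
have wE : w = (1 + m ^+ 2) / w by rewrite -w2 expr2 mulfK.
have dth : is_derive s 1 (fun x => w * K x) (w * k) by exact: is_deriveZ.
have dc : is_derive s 1 (fun x => cos (w * K x)) (- sin (w * K s) * (w * k)).
  exact: (is_derive1_comp (f := cos)).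
have ds : is_derive s 1 (fun x => sin (w * K x)) (cos (w * K s) * (w * k)).
  exact: (is_derive1_comp (f := sin)).
have scal (a : R) (f : R -> R) (df : R) :
    is_derive s 1 f df -> is_derive s 1 (fun x => a * f x) (a * df).
  by move=> df'; exact: is_deriveZ.
have row0 := is_derive_vec3 (scal w^-1 _ _ dc) (is_deriveN ds)
  (scal (- (m / w)) _ _ dc).
have row1 := is_derive_vec3 (scal w^-1 _ _ ds) dc (scal (- (m / w)) _ _ ds).
have row2 : is_derive s 1 (cst (vec3 (m / w) 0 w^-1)) 0 by exact: is_derive_cst.
apply: (is_derive_eq (is_derive_rows3 row0 row1 row2)).
apply/matrixP => i j; rewrite [RHS]mxE rows3_mul !mul_rows3.
elim/ord3P: i; rewrite !rows3E; elim/ord3P: j; rewrite !mxE/=.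
(* the two remaining entries, in the column of n, use w ^+ 2 = 1 + m ^+ 2 *)
all: try by field.
- by rewrite [X in - (_ * (X * k))]wE; field.
- by rewrite [X in - _ * (X * k)]wE; field.
Qed.
End moving_frame.

(** * General helices *)

Section helix.
Variables (R : realType) (I : set R) (alpha : R -> 'rV[R]_3) (tau : R -> R).
Hypotheses (I_itv : open_interval I)
    (alpha_diff : thrice_differentiable I alpha)
    (alpha_unit : unit_speed I alpha)
    (kappa_neq0 : forall s, I s -> curvature alpha s != 0)
    (tau_torsion : is_torsion I alpha tau).

Let kappa := curvature alpha.

Lemma curvature_continuous s : I s -> {for s, continuous kappa}.
Proof.
move=> Is.
have /(@derivableP _ _ _ _ _ _) da := alpha_diff (isT : (2 < 3)%N) Is.
have /is_derive_continuous dd := is_derive_dot da da.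
exact: (continuous_comp dd (@sqrt_continuous R _)).
Qed.

Lemma is_derive_curve s : I s -> is_derive s 1 alpha (tangent alpha s).
Proof.
move=> Is; have da := alpha_diff (isT : (0 < 3)%N) Is.
by apply: DeriveDef; [exact: da|rewrite /tangent derive1E].
Qed.

Lemma near_in s : I s -> \forall x \near s, I x.
Proof. by move=> Is; apply: open_nbhs_nbhs; split => //; case: I_itv. Qed.

Lemma helix_torsion_ratio : general_helix I alpha ->
  exists m : R, forall s, I s -> tau s / kappa s = m.
Proof.
have [oI Iitv] := I_itv.
move=> [_ [U [U1 [c tU]]]].
have dU (s : R) (f : R -> 'rV[R]_3) df : is_derive s 1 f df ->
    is_derive s 1 (fun x => dot (f x) U) (dot df U).
  move=> dfs; apply: (is_derive_eq (is_derive_dot dfs (is_derive_cst U s 1))).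
  by rewrite [X in _ + X]dotE !mxE !mulr0 !addr0.
have cst_dU (f : R -> _) (a : R) (s : R) df :
    I s -> (forall x, I x -> dot (f x) U = a) ->
    is_derive s 1 f df -> dot df U = 0.
  move=> Is fa /dU /(@derive_val _ _ _ _ _ _ _) <-.
  rewrite -(derive_cst a s 1); apply: near_eq_derive.
  near=> x; apply: fa; near: x; exact: near_in.
have dotZ a u : dot (a *: u) U = a * dot u U by rewrite !dotE !mxE; ring.
have dotD u v : dot (u + v) U = dot u U + dot v U by rewrite !dotE !mxE; ring.
have nU s : I s -> dot (normal alpha s) U = 0.
  move=> Is; have [dt _ _] := tau_torsion Is.
  have /eqP := cst_dU _ _ _ _ Is tU dt.
  by rewrite dotZ mulf_eq0 (negPf (kappa_neq0 Is)) => /eqP.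
have bU s : I s -> kappa s * c = tau s * dot (binormal alpha s) U.
  move=> Is; have [_ dn _] := tau_torsion Is.
  have := cst_dU _ _ _ _ Is nU dn.
  by rewrite dotD !dotZ tU// -/kappa; lra.
have [->|/set0P[s0 Is0]] := eqVneq I set0; first by exists 0.
pose d := dot (binormal alpha s0) U.
have bUd s : I s -> dot (binormal alpha s) U = d.
  pose f x := dot (binormal alpha x) U.
  move=> Is; apply: (is_derive0_cst_itv (f := f) Iitv) => // x Ix.
  have [_ _ db] := tau_torsion Ix.
  by apply: is_derive_eq (dU _ _ _ db) _; rewrite dotZ nU// mulr0.
(* if d = 0, all three coordinates of U in the Frenet frame vanish *)
have d0 : d != 0.
  apply/eqP => d0.
  have c0 : c = 0.
    apply/eqP; have /eqP := bU _ Is0; rewrite bUd// d0 mulr0 mulf_eq0.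
    by rewrite (negPf (kappa_neq0 Is0)).
  have [FF _] :=
    frame_orthogonal oI alpha_unit kappa_neq0 tau_torsion Is0.
  have : U *m (frame alpha s0)^T *m frame alpha s0 = U.
    by rewrite -mulmxA (mulmx1C FF) mulmx1.
  have dotC u : dot U u = dot u U by rewrite !dotE; ring.
  rewrite trmx_rows3 !dotC tU// nU// bUd// c0 d0 mul_rows3.
  rewrite !vec3E !scale0r !addr0.
  move=> U0; move: (enorm_eq1 U1).
  rewrite -U0 dotE !mxE !mulr0 !addr0 => /eqP.
  by rewrite eq_sym oner_eq0.
exists (c / d) => s Is; apply/eqP; rewrite eqr_div ?kappa_neq0//.
by rewrite -(bUd s)// -bU// mulrC.
Unshelve. all: by end_near. Qed.

Lemma torsion_ratio_param (m : R) (w := Num.sqrt (1 + m ^+ 2)) :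
  (forall s, I s -> tau s / kappa s = m) ->
  exists K X Y : R -> R,
    [/\ antiderivative I (curvature alpha) K,
        antiderivative I (fun s => cos (w * K s)) X,
        antiderivative I (fun s => sin (w * K s)) Y
      & exists M : 'rV[R]_3 -> 'rV[R]_3, rigid_motion M /\
          forall s, I s ->
            alpha s = M (vec3 (w^-1 * X s) (w^-1 * Y s) (m * s / w))].
Proof.
have [oI Iitv] := I_itv; have w0 : w != 0 := lt0r_neq0 (slant_norm_gt0 m).
move=> taum; have tauE s : I s -> tau s = m * kappa s.
  by move=> Is; rewrite -(taum s)// divfK// kappa_neq0.
have [K dK] := antiderivative_exists I_itv curvature_continuous.
have [I0|/set0P[s0 Is0]] := eqVneq I set0.
  exists K, id, id; split=> //; [by rewrite I0|by rewrite I0|].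
  exists id; split; last by rewrite I0.
  exists 1%:M, 0; split; rewrite ?det1 ?trmx1 ?mulmx1// => p.
  by rewrite mulmx1 addr0.
pose S s := slant m (w * K s); pose F := frame alpha.
pose rho := S s0 *m F s0.
have SF s : I s -> S s *m F s = rho.
  move=> Is.
  apply: (is_derive0_cst_itv_mx (M := fun x => S x *m F x) Iitv) => // x Ix.
  have dS : is_derive x 1 S _ := is_derive_slant m (dK _ Ix).
  have dF : is_derive x 1 F _ := is_derive_frame tau_torsion Ix.
  apply: is_derive_eq (is_derive_mulmx dS dF) _.
  by rewrite tauE// mulNmx mulmxA addNr.
have FF s : I s -> _ := fun Is =>
  frame_orthogonal oI alpha_unit kappa_neq0 tau_torsion Is.
have rhoT : rho *m rho^T = 1%:M.
  rewrite /rho trmx_mul mulmxA -[_ *m F s0 *m _]mulmxA (FF _ Is0).1 mulmx1.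
  exact: (slant_orthogonal _ _).1.
have det_rho : 0 < \det rho.
  by rewrite det_mulmx (slant_orthogonal _ _).2 (FF _ Is0).2 mulr1.
pose beta s := alpha s *m rho^T.
have dbeta s : I s -> is_derive s 1 beta
    (vec3 (w^-1 * cos (w * K s)) (w^-1 * sin (w * K s)) (m / w)).
  move=> Is; apply: (is_derive_eq
    (is_derive_mulmx (is_derive_curve Is) (is_derive_cst rho^T s 1))).
  rewrite mulmx0 addr0 /cst -[trmx rho]/(rho^T) -(SF s)// trmx_mul.
  have -> : tangent alpha s = vec3 1 0 0 *m F s.
    by rewrite mul_rows3 !vec3E scale1r !scale0r !addr0.
  rewrite mulmxA -[_ *m F s *m _]mulmxA (FF _ Is).1 mulmx1 trmx_rows3.
  by congr vec3; rewrite dotE !vec3E; ring.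
have dcoord s i : I s -> is_derive s 1 (fun x => beta x 0 i) _ :=
  fun Is => (is_derive_mxP _ _ _).1 (dbeta s Is) 0 i.
(* the height is affine in s; its offset d becomes part of the translation *)
pose d := beta s0 0 2%:R - m * s0 / w.
have height s : I s -> beta s 0 2%:R - m * s / w = d.
  pose f x := beta x 0 2%:R - m * x / w.
  move=> Is; apply: (is_derive0_cst_itv (f := f) Iitv) => // x Ix.
  have lin : is_derive x 1 (fun y => (m / w) * y) (m / w * 1).
    by apply: is_deriveZ; exact: is_derive_id.
  rewrite /f; under eq_fun do rewrite mulrAC.
  apply: is_derive_eq (is_deriveB (dcoord x 2%:R Ix) lin) _.
  by rewrite vec3E mulr1 subrr.
have dscale (s : R) i (f : R) :
    I s -> is_derive s 1 (fun x => beta x 0 i) (w^-1 * f) ->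
    is_derive s 1 (fun x => w * beta x 0 i) f.
  move=> Is df; apply: (is_derive_eq (is_deriveZ w df)).
  by rewrite -[_ *: _]/(_ * _) mulrA divff// mul1r.
exists K, (fun s => w * beta s 0 0), (fun s => w * beta s 0 1); split => //.
- by move=> s Is; apply: dscale => //; have := dcoord s 0 Is; rewrite vec3E.
- by move=> s Is; apply: dscale => //; have := dcoord s 1 Is; rewrite vec3E.
exists (fun p => p *m rho + vec3 0 0 d *m rho); split.
  by exists rho, (vec3 0 0 d *m rho).
move=> s Is; rewrite -mulmxDl.
have -> : vec3 (w^-1 * (w * beta s 0 0)) (w^-1 * (w * beta s 0 1))
    (m * s / w) + vec3 0 0 d = beta s.
  apply: row3P; rewrite mxE !vec3E ?addr0 ?mulKf//.
  by rewrite -(height s)// addrC subrK.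
by rewrite /beta -mulmxA (mulmx1C rhoT) mulmx1.
Qed.

Lemma param_helix (m : R) (w := Num.sqrt (1 + m ^+ 2)) (K X Y : R -> R)
    (M : 'rV[R]_3 -> 'rV[R]_3) :
  antiderivative I (fun s => cos (w * K s)) X ->
  antiderivative I (fun s => sin (w * K s)) Y ->
  rigid_motion M ->
  (forall s, I s ->
     alpha s = M (vec3 (w^-1 * X s) (w^-1 * Y s) (m * s / w))) ->
  general_helix I alpha.
Proof.
move=> dX dY [rho [c [rhoT _ ME]]] aE.
split => //; exists (vec3 0 0 1 *m rho).
have dot_rho u v : dot (u *m rho) (v *m rho) = dot u v.
  by rewrite !dot_mulmx trmx_mul mulmxA -[u *m rho *m _]mulmxA rhoT mulmx1.
split; first by rewrite /enorm dot_rho dotE !vec3E !mulr0 !add0r mulr1 sqrtr1.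
exists (m / w) => s Is.
have dZ (a : R) (f : R -> R) (df : R) :
    is_derive s 1 f df -> is_derive s 1 (fun x => a * f x) (a * df).
  by move=> df'; exact: is_deriveZ.
have dv := is_derive_vec3 (dZ w^-1 _ _ (dX s Is)) (dZ w^-1 _ _ (dY s Is))
  (dZ (m / w) _ _ (is_derive_id s 1)).
have da := is_deriveD (is_derive_mulmx dv (is_derive_cst rho s 1))
  (is_derive_cst c s 1).
pose v x := vec3 (w^-1 * X x) (w^-1 * Y x) (m / w * x).
have aE' : \forall x \near s, ((fun x => v x *m rho) + cst c) x = alpha x.
  near=> x; rewrite aE; last by near: x; exact: near_in.
  by rewrite ME (mulrAC m).
have := near_eq_is_derive aE' da.
move=> /(@derive_val _ _ _ _ _ _ _).
rewrite /tangent derive1E => ->; rewrite mulmx0 !addr0 dot_rho dotE !vec3E.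
by rewrite !mulr0 !add0r !mulr1.
Unshelve. all: by end_near. Qed.
End helix.

Theorem theorem3p2 (R : realType) (I : set R) (alpha : R -> 'rV[R]_3)
    (tau : R -> R)
    (I_itv : open_interval I)
    (alpha_diff : thrice_differentiable I alpha)
    (alpha_unit : unit_speed I alpha)
    (kappa_neq0 : forall s, I s -> curvature alpha s != 0)
    (tau_torsion : is_torsion I alpha tau) :
  [<-> general_helix I alpha;
       exists m : R, forall s, I s -> tau s / curvature alpha s = m;
       exists m : R, let w := Num.sqrt (1 + m ^+ 2) in
         exists K X Y : R -> R,
           [/\ antiderivative I (curvature alpha) K,
               antiderivative I (fun s => cos (w * K s)) X,
               antiderivative I (fun s => sin (w * K s)) Y
             & exists M : 'rV[R]_3 -> 'rV[R]_3, rigid_motion M /\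
                 forall s, I s ->
                   alpha s = M (vec3 (w^-1 * X s) (w^-1 * Y s) (m * s / w))]].
Proof.
tfae.
- exact: helix_torsion_ratio I_itv alpha_unit kappa_neq0 tau_torsion.
- move=> [m taum]; exists m.
  exact: (torsion_ratio_param I_itv _ _ _ tau_torsion).
- move=> [m /= [K [X [Y [_ dX dY [M [rigidM aE]]]]]]].
  exact: param_helix dX dY rigidM aE.
Qed.
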